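(* Let $m,n\ge2$. Every M-biquadratic tensor in $\mathbb{R}^{m\times n\times m\times n}$ is positive semi-definite. Every strong M-biquadratic tensor in $\mathbb{R}^{m\times n\times m\times n}$ is positive definite.
   Context: Write $[n]=\{1,\dots,n\}$. A biquadratic tensor is a real fourth-order tensor $\mathcal{A}=(a_{i_1j_1i_2j_2})\in\mathbb{R}^{m\times n\times m\times n}$, $i_1,i_2\in[m]$, $j_1,j_2\in[n]$, $m,n\ge2$; the set of these is $BQ(m,n)$. Entries $a_{ijij}$ are diagonal, all others off-diagonal. Put $f(\mathbf{x},\mathbf{y})=\sum_{i_1,i_2=1}^m\sum_{j_1,j_2=1}^n a_{i_1j_1i_2j_2}x_{i_1}y_{j_1}x_{i_2}y_{j_2}$. $\mathcal{A}$ is positive semi-definite if $f(\mathbf{x},\mathbf{y})\ge0$ for all $\mathbf{x},\mathbf{y}$, and positive definite if $f(\mathbf{x},\mathbf{y})>0$ whenever $\mathbf{x}^\top\mathbf{x}=\mathbf{y}^\top\mathbf{y}=1$. A real number $\lambda$ is an M-eigenvalue of $\mathcal{A}$ if there are real $\mathbf{x}\in\mathbb{R}^m$, $\mathbf{y}\in\mathbb{R}^n$ with $\mathbf{x}^\top\mathbf{x}=\mathbf{y}^\top\mathbf{y}=1$ such that for every $i\in[m]$ $$\sum_{i_1=1}^m\sum_{j_1,j_2=1}^n a_{i_1j_1ij_2}x_{i_1}y_{j_1}y_{j_2}+\sum_{i_2=1}^m\sum_{j_1,j_2=1}^n a_{ij_1i_2j_2}y_{j_1}x_{i_2}y_{j_2}=2\lambda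 x_i,$$ and for every $j\in[n]$ $$\sum_{i_1,i_2=1}^m\sum_{j_1=1}^n a_{i_1j_1i_2j}x_{i_1}y_{j_1}x_{i_2}+\sum_{i_1,i_2=1}^m\sum_{j_2=1}^n a_{i_1ji_2j_2}x_{i_1}x_{i_2}y_{j_2}=2\lambda y_j.$$ Every biquadratic tensor $\mathcal{B}$ has an M-eigenvalue; $\lambda_{\max}(\mathcal{B})$ denotes the largest one. The M-identity tensor $\mathcal{I}=(I_{i_1j_1i_2j_2})$ has $I_{i_1j_1i_2j_2}=1$ if $i_1=i_2$ and $j_1=j_2$, and $0$ otherwise. A Z-biquadratic tensor is one whose off-diagonal entries are all nonpositive; it can be written $\mathcal{A}=\alpha\mathcal{I}-\mathcal{B}$ with $\alpha\in\mathbb{R}$ and $\mathcal{B}\in BQ(m,n)$ entrywise nonnegative. If $\alpha\ge\lambda_{\max}(\mathcal{B})$ then $\mathcal{A}$ is an M-biquadratic tensor; if $\alpha>\lambda_{\max}(\mathcal{B})$ then $\mathcal{A}$ is a strong M-biquadratic tensor. *)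

(* Defs.v *)
From mathcomp Require Import all_boot all_order all_algebra.
From mathcomp Require Import all_classical all_reals.

Set Implicit Arguments.
Unset Strict Implicit.
Unset Printing Implicit Defensive.

Import Order.TTheory GRing.Theory Num.Theory.
Local Open Scope ring_scope.

Definition BQ (R : realType) (m n : nat) : Type :=
  'I_m -> 'I_n -> 'I_m -> 'I_n -> R.

Section Biquadratic.
Variables (R : realType) (m n : nat).
Implicit Types (A B : BQ R m n) (x : 'cV[R]_m) (y : 'cV[R]_n).

Definition biquadratic_form A x y : R :=
  \sum_(i1 < m) \sum_(i2 < m) \sum_(j1 < n) \sum_(j2 < n)
    A i1 j1 i2 j2 * x i1 0 * y j1 0 * x i2 0 * y j2 0.

Definition unit_vector k (v : 'cV[R]_k) : Prop := v^T *m v = 1%:M.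

Definition positive_semidefinite A : Prop :=
  forall x y, 0 <= biquadratic_form A x y.

Definition positive_definite A : Prop :=
  forall x y, unit_vector x -> unit_vector y -> 0 < biquadratic_form A x y.

Definition M_eigenvalue A (lambda : R) : Prop :=
  exists x y, [/\ unit_vector x, unit_vector y,
    forall i : 'I_m,
      \sum_(i1 < m) \sum_(j1 < n) \sum_(j2 < n)
        A i1 j1 i j2 * x i1 0 * y j1 0 * y j2 0
      + \sum_(i2 < m) \sum_(j1 < n) \sum_(j2 < n)
        A i j1 i2 j2 * y j1 0 * x i2 0 * y j2 0
      = 2 * lambda * x i 0 &
    forall j : 'I_n,
      \sum_(i1 < m) \sum_(i2 < m) \sum_(j1 < n)
        A i1 j1 i2 j * x i1 0 * y j1 0 * x i2 0
      + \sum_(i1 < m) \sum_(i2 < m) \sum_(j2 < n)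
        A i1 j i2 j2 * x i1 0 * x i2 0 * y j2 0
      = 2 * lambda * y j 0].

Definition largest_M_eigenvalue B (lambda : R) : Prop :=
  M_eigenvalue B lambda /\ forall mu, M_eigenvalue B mu -> mu <= lambda.

(* A total function: the default 0 is returned only if there is no largest
   M-eigenvalue, which does not happen when m and n are positive. *)
Definition lambda_max B : R := xget 0 (largest_M_eigenvalue B).

Lemma lambda_max_eq B lambda :
  largest_M_eigenvalue B lambda -> lambda_max B = lambda.
Proof.
move=> h; apply: xget_unique => // mu [mu_eig mu_max].
by case: h => l_eig l_max; apply/le_anti; rewrite l_max // mu_max.
Qed.

Definition M_identity : BQ R m n :=
  fun i1 j1 i2 j2 => ((i1 == i2) && (j1 == j2))%:R.

Definition Z_biquadratic A : Prop :=
  forall i1 j1 i2 j2, (i1, j1) != (i2, j2) -> A i1 j1 i2 j2 <= 0.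

Definition Z_decomposition A (alpha : R) B : Prop :=
  (forall i1 j1 i2 j2, 0 <= B i1 j1 i2 j2) /\
  (forall i1 j1 i2 j2,
     A i1 j1 i2 j2 = alpha * M_identity i1 j1 i2 j2 - B i1 j1 i2 j2).

Definition M_biquadratic A : Prop :=
  Z_biquadratic A /\
  exists alpha B, Z_decomposition A alpha B /\ lambda_max B <= alpha.

Definition strong_M_biquadratic A : Prop :=
  Z_biquadratic A /\
  exists alpha B, Z_decomposition A alpha B /\ lambda_max B < alpha.

End Biquadratic.

(* Main.v *)
Require Import Defs.
From mathcomp Require Import all_boot all_order all_algebra.
From mathcomp Require Import all_classical all_reals.
From mathcomp Require Import ring lra.
From mathcomp Require Import topology normedtype derive.

(** The whole proof rests on the identity: lambda_max of [B] is the maximum of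
    the biquadratic form [f_B] over the product of the two unit spheres.
    Granting it, homogeneity gives [f_B(x, y) <= lambda_max(B) |x|^2 |y|^2]
    ([biquadratic_form_le_lambda_max]), while
    [f_A(x, y) = alpha |x|^2 |y|^2 - f_B(x, y)] for [A = alpha I - B], and both
    claims follow.

    The maximum is attained by compactness ([biquadratic_form_max]).  At
    M-eigenvectors the form takes the M-eigenvalue as its value, so every
    M-eigenvalue is at most the maximum.  Conversely a maximizer [(x, y)] is a
    pair of M-eigenvectors: for fixed [y] the form is quadratic in [x], hence
    [x] maximizes a Rayleigh quotient, and likewise for [y].  The first-order
    condition ([rayleigh_max_eigen]) is obtained without differentiation: if
    [v^T G v <= lambda |v|^2] for all [v], with equality at [x], the positive
    semidefinite symmetric matrix [2 lambda I - (G + G^T)] has [x] as an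
    isotropic vector, and therefore as a kernel vector
    ([psd_isotropic_kernel]). *)

Set Implicit Arguments.
Unset Strict Implicit.
Unset Printing Implicit Defensive.

Import Order.TTheory GRing.Theory Num.Theory numFieldNormedType.Exports.
Local Open Scope ring_scope.

(** * Quadratic forms and their maximizers *)

Section QuadraticForms.
Variables (R : realType) (k : nat).
Implicit Types (G : 'M[R]_k) (v w x : 'cV[R]_k).

(** The scalar [v^T G w]. *)
Definition bform G v w : R := (v^T *m G *m w) 0 0.

(** The squared Euclidean norm. *)
Definition sqnorm v : R := (v^T *m v) 0 0.

Lemma sqnormE v : sqnorm v = \sum_i v i 0 ^+ 2.
Proof. by rewrite /sqnorm mxE; apply: eq_bigr => i _; rewrite mxE expr2. Qed.

Lemma bformE G v w : bform G v w = \sum_i \sum_j G i j * v i 0 * w j 0.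
Proof.
rewrite /bform -mulmxA mxE; apply: eq_bigr => i _.
by rewrite !mxE mulr_sumr; apply: eq_bigr => j _; rewrite mulrA [v i 0 * _]mulrC.
Qed.

Lemma bform_tr G v w : bform G^T v w = bform G w v.
Proof.
rewrite /bform.
have -> : v^T *m G^T *m w = (w^T *m G *m v)^T by rewrite !trmx_mul trmxK mulmxA.
by rewrite mxE.
Qed.

Lemma bformDr G v w x : bform G v (w + x) = bform G v w + bform G v x.
Proof. by rewrite /bform mulmxDr mxE. Qed.

Lemma bformDl G v w x : bform G (v + w) x = bform G v x + bform G w x.
Proof. by rewrite -bform_tr bformDr !bform_tr. Qed.

Lemma bformZr G a v w : bform G v (a *: w) = a * bform G v w.
Proof. by rewrite /bform -scalemxAr mxE. Qed.

Lemma bformZl G a v w : bform G (a *: v) w = a * bform G v w.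
Proof. by rewrite -bform_tr bformZr bform_tr. Qed.

Lemma unit_vectorE v : unit_vector v <-> sqnorm v = 1.
Proof.
rewrite /unit_vector /sqnorm; split=> [->|h]; first by rewrite mxE.
by apply/matrixP => i j; rewrite !ord1 h mxE.
Qed.

Lemma sqnorm_ge0 v : 0 <= sqnorm v.
Proof. by rewrite sqnormE sumr_ge0 // => i _; apply: sqr_ge0. Qed.

Lemma sqnorm_eq0 v : sqnorm v = 0 -> v = 0.
Proof.
rewrite sqnormE => /eqP; rewrite psumr_eq0; last by move=> i _; exact: sqr_ge0.
move=> /allP h; apply/matrixP => i j; rewrite ord1 mxE.
by apply/eqP; move: (h i); rewrite mem_index_enum /= sqrf_eq0 => ->.
Qed.

Lemma sqnormZ a v : sqnorm (a *: v) = a ^+ 2 * sqnorm v.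
Proof. by rewrite !sqnormE mulr_sumr; apply: eq_bigr => i _; rewrite mxE exprMn. Qed.

Lemma unit_vector_normalize v : sqnorm v != 0 ->
  unit_vector ((Num.sqrt (sqnorm v))^-1 *: v).
Proof.
move=> v0; apply/unit_vectorE.
by rewrite sqnormZ exprVn sqr_sqrtr ?sqnorm_ge0// mulVf.
Qed.

(** At a zero [x] of a positive semidefinite form the gradient vanishes: with
    [w = S x], the form along [x + t w] is [2 t |w|^2 + t^2 (w^T S w)], which
    is negative for small [t < 0] unless [w = 0]. *)
Lemma psd_isotropic_kernel (S : 'M[R]_k) x :
  S^T = S -> (forall v, 0 <= bform S v v) -> bform S x x = 0 -> S *m x = 0.
Proof.
move=> symS S_ge0 Sxx; set w := S *m x.
apply: sqnorm_eq0.
have Swx : bform S w x = sqnorm w by rewrite /bform -mulmxA.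
have Sxw : bform S x w = sqnorm w by rewrite -{1}symS bform_tr.
have expand t : bform S (x + t *: w) (x + t *: w) =
    2 * t * sqnorm w + t ^+ 2 * bform S w w.
  have -> : bform S (x + t *: w) (x + t *: w) =
      bform S x x + t * bform S x w + t * bform S w x + t ^+ 2 * bform S w w.
    rewrite bformDl !bformDr !bformZl !bformZr; ring.
  rewrite Sxx Swx Sxw; ring.
(* The step [t = - |w|^2 / (1 + w^T S w)] makes the value
   [- t^2 (2 + w^T S w)], which forces [w = 0]. *)
have := S_ge0 (x + (- (sqnorm w / (1 + bform S w w))) *: w).
rewrite expand.
have := S_ge0 w; set c := bform S w w; set a := sqnorm w => c0.
have c1 : 0 < 1 + c by lra.
have -> : 2 * - (a / (1 + c)) * a + (- (a / (1 + c))) ^+ 2 * c =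
    - ((a / (1 + c)) ^+ 2 * (2 + c)) by field; rewrite gt_eqF.
have c2 : 0 < 2 + c by lra.
rewrite oppr_ge0 (pmulr_lle0 _ c2) => le0.
have /eqP : (a / (1 + c)) ^+ 2 = 0 by apply: le_anti; rewrite le0 sqr_ge0.
by rewrite sqrf_eq0 mulf_eq0 invr_eq0 (gt_eqF c1) orbF => /eqP.
Qed.

(** The first-order condition for a maximizer of the Rayleigh quotient of [G]. *)
Lemma rayleigh_max_eigen G lambda x :
  (forall v, bform G v v <= lambda * sqnorm v) ->
  bform G x x = lambda * sqnorm x ->
  (G + G^T) *m x = (2 * lambda) *: x.
Proof.
move=> le_l eq_l.
have formE v : bform ((2 * lambda)%:M - (G + G^T)) v v =
    2 * (lambda * sqnorm v - bform G v v).
  have -> : bform ((2 * lambda)%:M - (G + G^T)) v v =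
      2 * lambda * sqnorm v - (bform G v v + bform G^T v v).
    rewrite /bform /sqnorm mulmxBr mulmxDr mulmxBl mulmxDl.
    by rewrite mul_mx_scalar -scalemxAl !mxE.
  rewrite bform_tr; ring.
have /eqP : ((2 * lambda)%:M - (G + G^T)) *m x = 0.
  apply: psd_isotropic_kernel.
  - by rewrite linearB linearD /= tr_scalar_mx trmxK [G^T + G]addrC.
  - by move=> v; rewrite formE mulr_ge0 // subr_ge0.
  - by rewrite formE eq_l subrr mulr0.
by rewrite mulmxBl mul_scalar_mx subr_eq0 => /eqP ->.
Qed.

(** The value of the form at an eigenvector of the symmetrized matrix. *)
Lemma eigen_bform G lambda x :
  (G + G^T) *m x = (2 * lambda) *: x -> bform G x x = lambda * sqnorm x.
Proof.
move=> eig.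
have : bform (G + G^T) x x = 2 * lambda * sqnorm x.
  by rewrite /bform -mulmxA eig -scalemxAr mxE.
have -> : bform (G + G^T) x x = bform G x x + bform G^T x x.
  by rewrite /bform mulmxDr mulmxDl mxE.
rewrite bform_tr; lra.
Qed.

End QuadraticForms.

(** * Biquadratic forms and M-eigenvalues *)

Section Biquadratic.
Variables (R : realType) (m n : nat).
Implicit Types (A B : BQ R m n) (x : 'cV[R]_m) (y : 'cV[R]_n).

(** The matrix of the quadratic form in [x] obtained by freezing [y]. *)
Definition row_slice A y : 'M[R]_m :=
  \matrix_(i1, i2) \sum_j1 \sum_j2 A i1 j1 i2 j2 * y j1 0 * y j2 0.

(** The matrix of the quadratic form in [y] obtained by freezing [x]. *)
Definition col_slice A x : 'M[R]_n :=
  \matrix_(j1, j2) \sum_i1 \sum_i2 A i1 j1 i2 j2 * x i1 0 * x i2 0.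

Lemma biquadratic_form_row A x y :
  biquadratic_form A x y = bform (row_slice A y) x x.
Proof.
rewrite bformE /biquadratic_form; apply: eq_bigr => i1 _; apply: eq_bigr => i2 _.
rewrite mxE !mulr_suml; apply: eq_bigr => j1 _.
by rewrite !mulr_suml; apply: eq_bigr => j2 _; ring.
Qed.

Lemma biquadratic_form_col A x y :
  biquadratic_form A x y = bform (col_slice A x) y y.
Proof.
rewrite bformE /biquadratic_form.
transitivity (\sum_i1 \sum_i2 \sum_j1 \sum_j2
   A i1 j1 i2 j2 * x i1 0 * x i2 0 * y j1 0 * y j2 0).
  by do 4 (apply: eq_bigr => ? _); ring.
rewrite pair_bigA exchange_big; apply: eq_bigr => j1 _ /=.
rewrite exchange_big; apply: eq_bigr => j2 _ /=.
by rewrite mxE pair_bigA !mulr_suml.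
Qed.

Lemma biquadratic_formZ A a b x y :
  biquadratic_form A (a *: x) (b *: y) = a ^+ 2 * b ^+ 2 * biquadratic_form A x y.
Proof.
rewrite /biquadratic_form; do 4 (rewrite mulr_sumr; apply: eq_bigr => ? _).
rewrite !mxE; ring.
Qed.

(** Both systems in the definition of an M-eigenvalue are eigenvector equations
    for the symmetrized slices. *)
Lemma M_eigenvalueE A lambda : M_eigenvalue A lambda <->
  exists x y, [/\ unit_vector x, unit_vector y,
    (row_slice A y + (row_slice A y)^T) *m x = (2 * lambda) *: x &
    (col_slice A x + (col_slice A x)^T) *m y = (2 * lambda) *: y].
Proof.
have rowE x y i : \sum_(i1 < m) \sum_(j1 < n) \sum_(j2 < n)
        A i1 j1 i j2 * x i1 0 * y j1 0 * y j2 0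
      + \sum_(i2 < m) \sum_(j1 < n) \sum_(j2 < n)
        A i j1 i2 j2 * y j1 0 * x i2 0 * y j2 0
    = ((row_slice A y + (row_slice A y)^T) *m x) i 0.
  rewrite mulmxDl addrC !mxE; congr (_ + _); apply: eq_bigr => i2 _;
  rewrite !mxE mulr_suml; apply: eq_bigr => j1 _;
  by rewrite mulr_suml; apply: eq_bigr => j2 _; ring.
have colE x y j : \sum_(i1 < m) \sum_(i2 < m) \sum_(j1 < n)
        A i1 j1 i2 j * x i1 0 * y j1 0 * x i2 0
      + \sum_(i1 < m) \sum_(i2 < m) \sum_(j2 < n)
        A i1 j i2 j2 * x i1 0 * x i2 0 * y j2 0
    = ((col_slice A x + (col_slice A x)^T) *m y) j 0.
  rewrite mulmxDl addrC !mxE; congr (_ + _);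
  rewrite pair_bigA exchange_big; apply: eq_bigr => j1 _ /=;
  rewrite !mxE pair_bigA mulr_suml; apply: eq_bigr => -[i1 i2] _ /=; ring.
split=> -[x [y [ux uy ex ey]]]; exists x, y; split => //.
- by apply/matrixP => i l; rewrite ord1 -rowE ex mxE.
- by apply/matrixP => i l; rewrite ord1 -colE ey mxE.
- by move=> i; rewrite rowE ex mxE.
- by move=> i; rewrite colE ey mxE.
Qed.

(** A bound on the unit spheres extends by homogeneity. *)
Lemma biquadratic_form_le_sqnorm A lambda :
  (forall x y, unit_vector x -> unit_vector y ->
     biquadratic_form A x y <= lambda) ->
  forall x y, biquadratic_form A x y <= lambda * (sqnorm x * sqnorm y).
Proof.
move=> le_l x y.
have [/sqnorm_eq0 ->|x0] := eqVneq (sqnorm x) 0.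
  rewrite -(scale0r (0 : 'cV[R]_m)) -[y in leLHS]scale1r biquadratic_formZ.
  by rewrite sqnormZ expr0n /= !(mulr0, mul0r).
have [/sqnorm_eq0 ->|y0] := eqVneq (sqnorm y) 0.
  rewrite -(scale0r (0 : 'cV[R]_n)) -[x in leLHS]scale1r biquadratic_formZ.
  by rewrite sqnormZ expr0n /= !(mulr0, mul0r).
have := le_l _ _ (unit_vector_normalize x0) (unit_vector_normalize y0).
rewrite biquadratic_formZ !exprVn !sqr_sqrtr ?sqnorm_ge0//.
have xy_gt0 : 0 < sqnorm x * sqnorm y.
  by rewrite mulr_gt0 // lt_neqAle eq_sym sqnorm_ge0 ?x0 ?y0.
by rewrite -invfM mulrC ler_pdivrMr.
Qed.

(** The value of the form at M-eigenvectors is the M-eigenvalue, so a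
    maximizer over the product of spheres yields the largest one. *)
Lemma maximizer_largest_M_eigenvalue A x y :
  unit_vector x -> unit_vector y ->
  (forall v w, unit_vector v -> unit_vector w ->
     biquadratic_form A v w <= biquadratic_form A x y) ->
  largest_M_eigenvalue A (biquadratic_form A x y).
Proof.
move=> ux uy le_l; split; last first.
  move=> mu /M_eigenvalueE[v [w [uv uw /eigen_bform ev _]]].
  have <- : biquadratic_form A v w = mu; last exact: le_l.
  by rewrite biquadratic_form_row ev (proj1 (unit_vectorE v) uv) mulr1.
have le_h := biquadratic_form_le_sqnorm le_l.
have [x1 y1] := (proj1 (unit_vectorE x) ux, proj1 (unit_vectorE y) uy).
apply/M_eigenvalueE; exists x, y; split=> //; apply: rayleigh_max_eigen.
- by move=> v; have := le_h v y; rewrite y1 mulr1 -biquadratic_form_row.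
- by rewrite x1 mulr1 -biquadratic_form_row.
- by move=> w; have := le_h x w; rewrite x1 mul1r -biquadratic_form_col.
- by rewrite y1 mulr1 -biquadratic_form_col.
Qed.

(** * Existence of a maximizer *)

Lemma continuous_sum (T : topologicalType) k (F : 'I_k -> T -> R) :
  (forall i, continuous (F i)) -> continuous (fun t => \sum_i F i t).
Proof.
by move=> cF; apply: continuous_big => // z; apply: add_continuous.
Qed.

Lemma continuous_mul (T : topologicalType) (f g : T -> R) :
  continuous f -> continuous g -> continuous (fun t => f t * g t).
Proof. by move=> cf cg t; apply: continuousM; [exact: cf | exact: cg]. Qed.

(** The pair [(x, y)] is encoded as a single row vector of length [m + n]; the
    product of the spheres is then a closed subset of the cube [[-1, 1]^(m+n)].
    Positivity of [m] and [n] makes both spheres nonempty. *)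
Lemma biquadratic_form_max A : (0 < m)%N -> (0 < n)%N ->
  exists x y, [/\ unit_vector x, unit_vector y &
    forall v w, unit_vector v -> unit_vector w ->
      biquadratic_form A v w <= biquadratic_form A x y].
Proof.
move=> m0 n0.
pose xpart (z : 'rV[R]_(m + n)) : 'cV[R]_m := (lsubmx z)^T.
pose ypart (z : 'rV[R]_(m + n)) : 'cV[R]_n := (rsubmx z)^T.
have xyK v w : xpart (row_mx v^T w^T) = v /\ ypart (row_mx v^T w^T) = w.
  by rewrite /xpart /ypart row_mxKl row_mxKr !trmxK.
have cx i : continuous (fun z => xpart z i 0).
  rewrite (_ : (fun z => _) = (fun z : 'rV[R]_(m + n) => z 0 (lshift n i))).
    exact: coord_continuous.
  by apply/funext => z; rewrite !mxE.
have cy j : continuous (fun z => ypart z j 0).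
  rewrite (_ : (fun z => _) = (fun z : 'rV[R]_(m + n) => z 0 (rshift m j))).
    exact: coord_continuous.
  by apply/funext => z; rewrite !mxE.
have cform : continuous (fun z => biquadratic_form A (xpart z) (ypart z)).
  do 4 (apply: continuous_sum => ?).
  do 4 (apply: continuous_mul; last by [exact: cx | exact: cy]).
  by move=> z; exact: cst_continuous.
pose K := [set z : 'rV[R]_(m + n) |
  sqnorm (xpart z) = 1 /\ sqnorm (ypart z) = 1]%classic.
have closed_sphere k (p : 'rV[R]_(m + n) -> 'cV[R]_k) :
    (forall i, continuous (fun z => p z i 0)) ->
    closed [set z | sqnorm (p z) = 1]%classic.
  move=> cp; apply: (@closed_comp _ _ (fun z => sqnorm (p z)) [set 1]%classic);
    last exact: closed_eq.
  move=> z _.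
  have : continuous (fun z => \sum_i p z i 0 * p z i 0).
    by apply: continuous_sum => i; apply: continuous_mul; exact: cp.
  rewrite (_ : (fun z => _) = (fun z => sqnorm (p z))); first exact.
  by apply/funext => t; rewrite sqnormE; apply: eq_bigr => i _; rewrite expr2.
have Kclosed : closed K by apply: closedI; exact: closed_sphere.
have coord_le1 k (v : 'cV[R]_k) i : sqnorm v = 1 -> v i 0 \in `[-1, 1].
  rewrite sqnormE (bigD1 i) //= in_itv /= => v1.
  have : 0 <= \sum_(j | j != i) v j 0 ^+ 2.
    by apply: sumr_ge0 => j _; exact: sqr_ge0.
  by move=> ?; apply/andP; split; nra.
have Kcompact : compact K.
  apply: (subclosed_compact Kclosed
    (rV_compact (fun _ : 'I_(m + n) => @segment_compact R (-1) 1))).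
  move=> z [zx zy] i; case: (split_ordP i) => j -> /=.
  - by have := coord_le1 _ _ j zx; rewrite !mxE.
  - by have := coord_le1 _ _ j zy; rewrite !mxE.
have unit_delta k (i : 'I_k) : sqnorm (delta_mx i 0 : 'cV[R]_k) = 1.
  rewrite sqnormE (bigD1 i) //= big1 ?mxE ?eqxx ?expr1n ?addr0 //.
  by move=> j ji; rewrite mxE (negPf ji) expr0n.
have K0 : (K !=set0)%classic.
  exists (row_mx (delta_mx (Ordinal m0) 0)^T (delta_mx (Ordinal n0) 0)^T).
  by rewrite /K /=; case: (xyK (delta_mx (Ordinal m0) 0) (delta_mx (Ordinal n0) 0))
    => -> ->; rewrite !unit_delta.
have [z zK zmax] := compact_EVT_max K0 Kcompact (continuous_subspaceT cform).
move: zK; rewrite inE => -[zx zy].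
exists (xpart z), (ypart z); split; [exact/unit_vectorE..|].
move=> v w /unit_vectorE uv /unit_vectorE uw.
have [xE yE] := xyK v w; have := zmax (row_mx v^T w^T).
by rewrite inE /K /= xE yE; apply.
Qed.

(** * Comparison with the largest M-eigenvalue *)

Lemma biquadratic_form_le_lambda_max A x y : (0 < m)%N -> (0 < n)%N ->
  biquadratic_form A x y <= lambda_max A * (sqnorm x * sqnorm y).
Proof.
move=> m0 n0; have [v [w [uv uw vw_max]]] := biquadratic_form_max A m0 n0.
have /lambda_max_eq -> := maximizer_largest_M_eigenvalue uv uw vw_max.
exact: biquadratic_form_le_sqnorm.
Qed.

Lemma biquadratic_form_identity x y :
  biquadratic_form (@M_identity R m n) x y = sqnorm x * sqnorm y.
Proof.
rewrite biquadratic_form_row !sqnormE bformE mulr_suml; apply: eq_bigr => i _.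
rewrite (bigD1 i) //= [X in _ + X]big1 ?addr0; last first.
  move=> i2 i2i; rewrite mxE big1 ?mul0r // => j1 _; rewrite big1 // => j2 _.
  by rewrite /M_identity eq_sym (negPf i2i) /= !mul0r.
rewrite mxE -mulrA mulrC -expr2; congr (_ * _); apply: eq_bigr => j _.
rewrite (bigD1 j) //= [X in _ + X]big1 ?addr0; last first.
  by move=> j2 j2j; rewrite /M_identity [j == _]eq_sym (negPf j2j) andbF !mul0r.
by rewrite /M_identity !eqxx mul1r expr2.
Qed.

Lemma biquadratic_form_decomposition A alpha B x y : Z_decomposition A alpha B ->
  biquadratic_form A x y =
    alpha * (sqnorm x * sqnorm y) - biquadratic_form B x y.
Proof.
move=> [_ AE]; rewrite -biquadratic_form_identity /biquadratic_form.
do 4 (rewrite mulr_sumr -sumrB; apply: eq_bigr => ? _).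
rewrite AE; ring.
Qed.

End Biquadratic.

Theorem proposition5p2 (R : realType) (m n : nat)
    (hm : (2 <= m)%N) (hn : (2 <= n)%N) :
  (forall A : BQ R m n, M_biquadratic A -> positive_semidefinite A) /\
  (forall A : BQ R m n, strong_M_biquadratic A -> positive_definite A).
Proof.
have m0 : (0 < m)%N by apply: leq_trans hm.
have n0 : (0 < n)%N by apply: leq_trans hn.
split=> A [_ [alpha [B [AB le_alpha]]]] x y.
  rewrite (biquadratic_form_decomposition x y AB) subr_ge0.
  apply: le_trans (biquadratic_form_le_lambda_max B x y m0 n0) _.
  by rewrite ler_wpM2r // mulr_ge0 // sqnorm_ge0.
move=> /unit_vectorE ux /unit_vectorE uy.
rewrite (biquadratic_form_decomposition x y AB) subr_gt0.
apply: le_lt_trans (biquadratic_form_le_lambda_max B x y m0 n0) _.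
by rewrite ux uy !mulr1.
Qed.
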